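(* For all $k\ge 1$ and $n\ge 2$, the number of permutations $\sigma\in S_n(231)$ with $\mathrm{maxdrop}(\sigma)\le k$ and $\mathrm{des}(\sigma)=1$ equals $\binom{n}{2}$.
   Context: For a permutation $\sigma=\sigma_1\cdots\sigma_n$ of $[n]$, $\mathrm{des}(\sigma)$ is the number of $i\in[n-1]$ with $\sigma_i>\sigma_{i+1}$, and $\mathrm{maxdrop}(\sigma)=\max\{i-\sigma_i : i\in[n]\}$. $S_n(231)$ is the set of permutations of $[n]$ with no indices $a<b<c$ such that $\sigma_c<\sigma_a<\sigma_b$. *)

(* Defs.v *)
From mathcomp Require Import all_boot all_order fingroup perm ssralg ssrnum ssrint.

Set Implicit Arguments.
Unset Strict Implicit.
Unset Printing Implicit Defensive.

Local Open Scope nat_scope.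

(* Permutations of [n] are elements of 'S_n = {perm 'I_n}, so positions and
   values both range over 0, ..., n-1 instead of 1, ..., n. *)

Definition des (n : nat) (s : 'S_n) : nat :=
  #|[set i : 'I_n | [exists j : 'I_n, (j == i.+1 :> nat) && (s j < s i)]]|.

(* The shift of positions and values to start at 0 cancels in i - s i. The
   subtraction is truncated, which is harmless: i - s i >= 0 at the position i
   of the value 0, so the maximum of the integer differences is nonnegative;
   see maxdrop_ub and maxdrop_attained. *)
Definition maxdrop (n : nat) (s : 'S_n) : nat := \max_(i < n) (i - s i).

Definition avoids231 (n : nat) (s : 'S_n) : bool :=
  ~~ [exists a : 'I_n, exists b : 'I_n, exists c : 'I_n,
        [&& a < b, b < c, s c < s a & s a < s b]].

Lemma maxdrop_ub (n : nat) (s : 'S_n) (i : 'I_n) :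
  (i%:Z - (s i)%:Z <= (maxdrop s)%:Z)%R.
Proof.
rewrite Num.Theory.lerBlDr -PoszD lez_nat addnC -leq_subLR.
exact: (@leq_bigmax _ (fun j : 'I_n => j - s j) i).
Qed.

Lemma maxdrop_attained (n : nat) (s : 'S_n) :
  0 < n -> exists i : 'I_n, (i%:Z - (s i)%:Z = (maxdrop s)%:Z)%R.
Proof.
move=> n_gt0; pose z := Ordinal n_gt0.
have [i def_m]: {i : 'I_n | maxdrop s = i - s i}.
  by apply: eq_bigmax; rewrite card_ord.
have [le_si_i | /ltnW] := leqP (s i) i.
  by exists i; rewrite def_m subzn.
rewrite -subn_eq0 -def_m => /eqP m0.
have := maxdrop_ub s ((s^-1)%g z). rewrite m0 permKV GRing.subr0 lez_nat.
rewrite leqn0 => /eqP pz0.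
by exists ((s^-1)%g z); rewrite permKV pz0.
Qed.

(* Main.v *)
Require Import Defs.
From mathcomp Require Import all_boot fingroup perm.
From mathcomp Require Import zify.

Set Implicit Arguments.
Unset Strict Implicit.
Unset Printing Implicit Defensive.

(** A permutation with its only descent at [p] that avoids 231 is increasing
    away from [p], so it is the cycle that moves some value [q > p] to position
    [p] and shifts the values [p, ..., q - 1] one place to the right. Such a
    cycle has maxdrop 1, so the bound [k] excludes nothing, and the permutations
    counted correspond to the pairs [p < q]. *)

Definition shift_val (p q i : nat) : nat :=
  if i == p then q else if p < i <= q then i.-1 else i.

Lemma shift_val_ltn n (p q i : 'I_n) : shift_val p q i < n.
Proof. by rewrite /shift_val; case: ifP => // _; case: ifP => // _; have := ltn_ord i; lia. Qed.

Definition shift_ord n (p q i : 'I_n) : 'I_n := Ordinal (shift_val_ltn p q i).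

(* For [q < p], [shift_val p q] is not injective; exchanging the two indices
   then makes [shift_perm] total. *)
Lemma shift_ord_inj n (p q : 'I_n) :
  injective (if p < q then shift_ord p q else shift_ord q p).
Proof.
by case: ifP => ltpq i j /(congr1 val) /=; rewrite /shift_val;
  do ![case: ifP => ?] => ?; apply: val_inj => /=; lia.
Qed.

Definition shift_perm n (p q : 'I_n) : 'S_n := perm (@shift_ord_inj n p q).

Lemma shift_permE n (p q i : 'I_n) :
  p < q -> shift_perm p q i = shift_val p q i :> nat.
Proof. by move=> ltpq; rewrite permE ltpq. Qed.

(** An inversion starts at [p] and ends at a position at most [q]; the positions strictly in between
    carry values below [q], so none can play the 3. *)
Lemma shift_perm_avoids231 n (p q : 'I_n) : p < q -> avoids231 (shift_perm p q).
Proof.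
move=> ltpq; apply/existsP => -[a /existsP[b /existsP[c]]].
by rewrite !shift_permE // /shift_val; do ![case: ifP => ?]; lia.
Qed.

Lemma shift_perm_maxdrop n (p q : 'I_n) : p < q -> maxdrop (shift_perm p q) <= 1.
Proof.
move=> ltpq; apply/bigmax_leqP => i _.
by rewrite shift_permE // /shift_val; do ![case: ifP => ?]; lia.
Qed.

Lemma shift_perm_des n (p q : 'I_n) : p < q -> des (shift_perm p q) = 1.
Proof.
move=> ltpq; rewrite -(cards1 p) /des; congr #|pred_of_set _|; apply/setP => i.
rewrite !inE -val_eqE /=; apply/existsP/eqP => [[j] | eq_ip].
  by rewrite !shift_permE // /shift_val; do ![case: ifP => ?]; lia.
have ltSp : p.+1 < n by have := ltn_ord q; lia.
exists (Ordinal ltSp); rewrite !shift_permE // /shift_val /=; do ![case: ifP => ?]; lia.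
Qed.

(** With [m = s i], this recovers a value from its comparisons with the other values alone. *)
Lemma card_perm_ltn n (s : 'S_n) (m : 'I_n) : #|[set j | s j < m]| = m.
Proof.
have -> : [set j | s j < m] = s @^-1: [set v : 'I_n | v < m].
  by apply/setP => j; rewrite !inE.
rewrite card_preimset; last exact: perm_inj.
by rewrite -sum1dep_card (big_ord_narrow (ltnW (ltn_ord m))) sum1_card card_ord.
Qed.

Lemma des1_descent n (s : 'S_n) : des s = 1 ->
  exists2 p : 'I_n, (exists2 j : 'I_n, j = p.+1 :> nat & s j < s p) &
    forall i j : 'I_n, i != p -> j = i.+1 :> nat -> s i < s j.
Proof.
move/eqP/cards1P => [p defD]; exists p.
  have: p \in [set p] by rewrite set11.
  by rewrite -defD inE => /existsP[j /andP[/eqP ej lt_j]]; exists j.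
move=> i j; rewrite -in_set1 -defD inE => /existsPn/(_ j) + ej.
rewrite ej eqxx /= -leqNgt leq_eqVlt => /orP[/eqP/val_inj/perm_inj eij|//].
by move: ej; rewrite eij; lia.
Qed.

(** Ascents are required only at positions in [[i, j)], so that a chain of them may end at the
    descent or start just after it. *)
Lemma ltn_of_step n (f : 'I_n -> nat) (i j : 'I_n) :
    (forall a b : 'I_n, i <= a < j -> b = a.+1 :> nat -> f a < f b) ->
  i < j -> f i < f j.
Proof.
case: j => m ltmn /=; elim: m ltmn => // m IHm ltmn step.
have ltmn' : m < n by exact: ltnW.
rewrite ltnS => lei; have step_m := step (Ordinal ltmn') (Ordinal ltmn).
have {step_m}: f (Ordinal ltmn') < f (Ordinal ltmn) by apply: step_m => //=; lia.
case: (ltngtP i m) lei => // [ltim _ | eim _].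
  by apply: ltn_trans; apply: IHm => // a b ab; apply: step; lia.
by have -> : i = Ordinal ltmn' by apply: val_inj.
Qed.

Lemma avoids231_des1_shift n (s : 'S_n) : avoids231 s -> des s = 1 ->
  exists2 pq : 'I_n * 'I_n, pq.1 < pq.2 & s = shift_perm pq.1 pq.2.
Proof.
move=> av /des1_descent[p [p1 ep1 desc_p] step].
have mono (i j : 'I_n) : i != p -> i < j -> s i < s j.
  rewrite -val_eqE /= => nip ltij.
  (* Unless [i < p < j], ascents alone lead from [i] to [j]. Otherwise they lead from [i] to [p],
     and [s j < s i] would make [i], [p], [j] a 231 pattern. *)
  have [out | /negbNE/andP[ltip ltpj]] := boolP (~~ (i < p < j)).
    apply: (ltn_of_step (f := fun x => s x)) => // a b ab eb.
    by apply: step => //; rewrite -val_eqE /=; lia.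
  have ltsip : s i < s p.
    apply: (ltn_of_step (f := fun x => s x)) => // a b ab eb.
    by apply: step => //; rewrite -val_eqE /=; lia.
  have nsij : s i != s j :> nat.
    by apply: contraTneq ltij => /val_inj/perm_inj->; rewrite ltnn.
  move: av => /existsPn/(_ i)/existsPn/(_ p)/existsPn/(_ j).
  by rewrite ltip ltpj ltsip /=; lia.
have monoE (i j : 'I_n) : i != p -> j != p -> (s j < s i) = (j < i).
  move=> nip njp; case: (ltngtP j i) => [|lt_ij|/val_inj->]; last by rewrite ltnn.
    exact: mono.
  by apply/negbTE; rewrite -leqNgt ltnW // mono.
(* Count the values below [s i]: off [p] they sit exactly at the positions before [i], and [p]
   contributes separately. *)
have count (i : 'I_n) : i != p -> s i = (i - (p < i)) + (s p < s i) :> nat.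
  move=> nip; rewrite -{1}(card_perm_ltn s (s i)) (cardsD1 p) inE addnC.
  congr (_ + _).
  have -> : [set j | s j < s i] :\ p = [set j : 'I_n | (1%g : 'S_n) j < i] :\ p.
    apply/setP => j; rewrite !inE perm1; have [//|njp] := eqVneq j p.
    exact: monoE.
  have := card_perm_ltn 1%g i; rewrite [X in X = _](cardsD1 p) inE perm1.
  by move/(canRL (addKn _)).
(* At [p1 = p + 1], just after the descent, [count] gives [s p1 = p], and [s p1 < s p]. *)
have ltpq : p < s p.
  have np1 : p1 != p by rewrite -val_eqE /= ep1; lia.
  by have := count _ np1; lia.
exists (p, s p) => //=; apply/permP => i; apply: val_inj; rewrite /= shift_permE //.
rewrite /shift_val; have [/val_inj-> // | nip] := eqVneq (i : nat) p.
have nip' : i != p := nip.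
have nsip : s i != s p :> nat by apply: contraNneq nip' => /val_inj/perm_inj->.
have := count _ nip'.
(* Before [p], this makes the last term of [count] vanish; after [p], that term separates [i <= s p]
   from [i > s p]. *)
have : i < p -> s i < s p by apply: mono.
case: ifP => ?; lia.
Qed.

Lemma shift_perm_inj n :
  {in [set pq : 'I_n * 'I_n | pq.1 < pq.2] &,
    injective (fun pq => shift_perm pq.1 pq.2)}.
Proof.
move=> [p q] [p' q']; rewrite !inE /= => ltpq ltpq' eqs.
have eqv (i : 'I_n) : shift_val p q i = shift_val p' q' i.
  by rewrite -!shift_permE ?eqs.
have eqp : p = p'.
  (* If [p] and [p'] differed, the smaller one would be fixed by one map and raised by the other. *)
  apply: val_inj; move: (eqv p) (eqv p'); rewrite /shift_val !eqxx /=.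
  do ![case: ifP => ?]; lia.
move: (eqv p); rewrite /shift_val -eqp !eqxx => /val_inj->.
by rewrite eqp.
Qed.

(** Each [q] has [q] smaller partners, and these numbers sum to the binomial coefficient. *)
Lemma card_ltn_pairs n : #|[set pq : 'I_n * 'I_n | pq.1 < pq.2]| = 'C(n, 2).
Proof.
rewrite -sum1_card big_set /=.
rewrite -(pair_big_dep xpredT (fun p q : 'I_n => p < q) (fun _ _ => 1)) /=.
rewrite (exchange_big_dep xpredT) //= -bin2_sum big_mkord.
apply: eq_bigr => q _.
by rewrite sum1dep_card -[RHS](card_perm_ltn 1 q); apply: eq_card => p;
  rewrite !inE perm1.
Qed.

Theorem theorem3 (k n : nat) (hk : 1 <= k) (hn : 2 <= n) :
  #|[set s : 'S_n | [&& avoids231 s, maxdrop s <= k & des s == 1]]| = 'C(n, 2).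
Proof.
rewrite -card_ltn_pairs -(card_in_imset (@shift_perm_inj n)).
apply: eq_card => s; rewrite inE; apply/and3P/imsetP.
  move=> [av _ /eqP /(avoids231_des1_shift av) [pq ltpq ->]].
  by exists pq; rewrite ?inE.
move=> [[p q]]; rewrite inE /= => ltpq ->.
by rewrite shift_perm_avoids231 // shift_perm_des // (leq_trans (shift_perm_maxdrop _)).
Qed.
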